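(* Under the assumptions below, the eigenvalues $\widetilde{\lambda}_n$ of the differential operator $\mathbf{L}$ associated with the polynomials $q_n$ orthonormal with respect to the discrete Sobolev inner product $(f,g)_S$ satisfy: If $j=2r$, $$\lim_{n\to+\infty}\frac{\widetilde{\lambda}_{2r+2n}}{n^{2(a_1r+b_1)+3}}=\frac{8\gamma MC_{r,1}^2}{(2(a_1r+b_1)+3)(2(a_1r+b_1)+1)}\ \text{if }\gamma\neq0,\qquad \lim_{n\to+\infty}\frac{\widetilde{\lambda}_{2r+2n}}{n^{2(a_1r+b_1+1)}}=\frac{\delta MC_{r,1}^2}{(a_1r+b_1+1)(2(a_1r+b_1)+1)}\ \text{if }\gamma=0.$$ If $j=2r+1$, $$\lim_{n\to+\infty}\frac{\widetilde{\lambda}_{2r+1+2n}}{n^{2(a_2r+b_2)+3}}=\frac{8\gamma MC_{r,2}^2}{(2(a_2r+b_2)+3)(2(a_2r+b_2)+1)}\ \text{if }\gamma\neq0,\qquad \lim_{n\to+\infty}\frac{\widetilde{\lambda}_{2r+1+2n}}{n^{2(a_2r+b_2+1)}}=\frac{\delta MC_{r,2}^2}{(a_2r+b_2+1)(2(a_2r+b_2)+1)}\ \text{if }\gamma=0.$$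
   Context: Let $\mu$ be a classical measure on the real line symmetric with respect to the origin, $d\mu(x)=w(x)dx$ (e.g. Hermite weight $e^{-x^2}$ or Gegenbauer weight $(1-x^2)^{\alpha}$, $\alpha>-1$), take $c=0$, and consider the discrete Sobolev inner product $(f,g)_S=\int f(x)g(x)\,d\mu+Mf^{(j)}(0)g^{(j)}(0)$ with $j\in\mathbb{N}\cup\{0\}$ and $M>0$. Let $\{p_n\}_{n\ge0}$ be the orthonormal polynomials with respect to $\mu$, eigenfunctions of the operator $\mathbf{B}=\sigma(x)\mathcal{D}^2+\tau(x)\mathcal{D}$ with eigenvalues $\lambda_n$, and let $\{q_n\}_{n\ge0}$ be the orthonormal polynomials with respect to $(f,g)_S$, which are eigenfunctions of a differential operator $\mathbf{L}=\sum_{i\ge1}r_i(x)\mathcal{D}^i$ ($\deg r_i\le i$) with eigenvalues $\widetilde{\lambda}_n=\lambda_n+M\alpha_n$, where $\alpha_i=0$ for $i\in\{0,\dots,j\}$ and $\alpha_{j+2n}=\sum_{i=1}^n(\lambda_{j+2i}-\lambda_{j+2i-2})K_{j+2i-1}^{(j,j)}(0,0)$ for $n\ge1$, with $K_n^{(r,s)}(x,y)=\sum_{i=0}^np_i^{(r)}(x)p_i^{(s)}(y)$. Assume $p_{2n}^{(2k)}(0)\approx C_{k,1}(-1)^n n^{a_1k+b_1}$ and $p_{2n+1}^{(2k+1)}(0)\approx C_{k,2}(-1)^n n^{a_2k+b_2}$ (where $a_n\approx b_n$ means $a_n/b_n\to1$), with constants $C_{k,1},C_{k,2}$ independent of $n$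 and $2(a_1k+b_1)+1>0$, $2(a_2k+b_2)+1>0$, and assume $\lambda_n=\gamma n^2+\delta n$ with $\gamma,\delta\in\mathbb{R}$. *)

(* Defs.v *)
From HB Require Import structures.
From mathcomp Require Import all_boot all_order all_algebra.
From mathcomp Require Import all_classical all_reals all_analysis.
Set Implicit Arguments. Unset Strict Implicit. Unset Printing Implicit Defensive.
Import Order.TTheory GRing.Theory Num.Theory.
Local Open Scope ring_scope.

Definition Kjj0 (R : realType) (p : nat -> {poly R}) (j n : nat) : R :=
  \sum_(i < n.+1) ((p i)^`(j)).[0] ^+ 2.

Definition alpha_shift (R : realType) (lam : nat -> R) (p : nat -> {poly R})
    (j n : nat) : R :=
  \sum_(1 <= i < n.+1)
     (lam (j + 2 * i)%N - lam (j + 2 * i - 2)%N) * Kjj0 p j (j + 2 * i - 1)%N.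

Definition tlambda_shift (R : realType) (lam : nat -> R) (p : nat -> {poly R})
    (M : R) (j n : nat) : R :=
  lam (j + 2 * n)%N + M * alpha_shift lam p j n.

(* Main.v *)
(** Symmetry of [mu] forces [p n] to have the parity of [n], so only the indices
of the parity of [j] contribute to the kernel [K^(j,j)(0,0)], and there the
hypothesis gives terms equivalent to [C ^ 2 * n ^ (2 * e)].  By Stolz-Cesaro,
summing a sequence equivalent to [c * n ^ s] with [s > -1] yields one equivalent
to [c / (s + 1) * n ^ (s + 1)].  Applying this to the kernel, multiplying by the
increments of [lambda] (of order [n] or [1]) and applying it again to [alpha]
gives the limit; [lambda] itself is of lower order because [2 * e + 1 > 0]. *)

Require Import Defs.
From HB Require Import structures.
From mathcomp Require Import all_boot all_order all_algebra.
From mathcomp Require Import all_classical all_reals all_analysis.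
Import Order.TTheory GRing.Theory Num.Theory numFieldNormedType.Exports.
Local Open Scope classical_set_scope.
Local Open Scope ring_scope.
From mathcomp Require Import ring lra zify.

(** * Parity of orthonormal polynomials under a symmetric functional *)

Lemma coef_comp_polyNX (R : comNzRingType) (p : {poly R}) (i : nat) :
  (p \Po - 'X)`_i = (-1) ^+ i * p`_i.
Proof.
rewrite coef_comp_poly.
under eq_bigr do rewrite exprNn -polyCN -polyC_exp coefCM coefXn.
have [ip|pi] := ltnP i (size p).
  rewrite (bigD1 (Ordinal ip)) //= eqxx mulr1 big1 ?addr0 1?mulrC // => k kN.
  by rewrite -val_eqE eq_sym in kN; rewrite (negPf kN) !mulr0.
rewrite nth_default // mulr0 big1 // => k _.
by rewrite gtn_eqF ?mulr0 // (leq_trans (ltn_ord k)).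
Qed.

(** Triangular elimination: [p n] has exact degree [n], so subtracting a multiple of it cancels the
    coefficient of degree [n]. *)
Lemma poly_basis_span {R : fieldType} {p : nat -> {poly R}} {n : nat}
    {f : {poly R}} :
  (forall k, size (p k) = k.+1) -> (size f <= n)%N ->
  exists c : nat -> R, f = \sum_(k < n) c k *: p k.
Proof.
move=> sp; elim: n f => [|n IH] f sf.
  exists (fun=> 0); rewrite big_ord0.
  by apply/eqP; rewrite -size_poly_eq0 -leqn0.
have pn0 : lead_coef (p n) != 0 by rewrite lead_coef_eq0 -size_poly_eq0 sp.
pose a := f`_n / lead_coef (p n).
have [|c fc] := IH (f - a *: p n).
  apply/leq_sizeP => i; rewrite leq_eqVlt => /predU1P[<-|ni].
    rewrite coefB coefZ; have -> : (p n)`_n = lead_coef (p n).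
      by rewrite lead_coefE sp.
    by rewrite divfK // subrr.
  by rewrite coefB coefZ !nth_default ?mulr0 ?subrr ?sp // (leq_trans sf).
exists (fun k => if k == n then a else c k).
rewrite big_ord_recr /= eqxx; under eq_bigr => k _ do rewrite ltn_eqF ?ltn_ord //.
by rewrite -fc subrK.
Qed.

(** The difference [d] of the two sides loses its leading term, so its degree is below [n];
    invariance of [L] makes it orthogonal to every polynomial of degree below [n], hence zero. An
    abstract functional [L] keeps the argument free of integration theory. *)
Lemma orthonormal_comp_polyNX {R : fieldType} {L : {poly R} -> R}
    {p : nat -> {poly R}} (n : nat) :
  scalar L -> (forall f, L (f \Po - 'X) = L f) ->
  (forall k, size (p k) = k.+1) ->
  (forall k l, L (p k * p l) = (k == l)%:R) ->
  p n \Po - 'X = (-1) ^+ n *: p n.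
Proof.
move=> linL symL sp orth.
pose LL : {scalar {poly R}} := HB.pack L (GRing.isLinear.Build R {poly R} R *%R L linL).
have LE f : L f = LL f by [].
have orthP (f : {poly R}) : (size f <= n)%N -> L (p n * f) = 0.
  move=> /(poly_basis_span sp)[c ->].
  rewrite LE mulr_sumr linear_sum big1 // => k _.
  by rewrite -scalerAr linearZ /= orth gtn_eqF ?mulr0.
pose d := p n \Po - 'X - (-1) ^+ n *: p n.
have sd : (size d <= n)%N.
  apply/leq_sizeP => i; rewrite leq_eqVlt coefB coef_comp_polyNX coefZ.
  case/predU1P => [<-|ni]; first by rewrite subrr.
  by rewrite nth_default ?sp // !mulr0 subrr.
have dorth (f : {poly R}) : (size f <= n)%N -> L (d * f) = 0.
  move=> sf; rewrite mulrBl LE linearB -scalerAl linearZ /= orthP //.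
  (* With [f] itself written as a reflection, the whole product under [L] is reflected and
     invariance applies. *)
  have fE : f = (f \Po - 'X) \Po - 'X.
    by apply/polyP => i; rewrite !coef_comp_polyNX signrMK.
  rewrite [in X in L (_ * X) - _]fE -comp_polyM symL orthP ?mulr0 ?subrr //.
  apply/leq_sizeP => i ni; rewrite coef_comp_polyNX nth_default ?mulr0 //.
  exact: leq_trans ni.
apply/eqP; rewrite -subr_eq0 -/d; apply/eqP.
have [c dE] := poly_basis_span sp sd.
(* Testing [d] against [p k] extracts its coefficient [c k]. *)
rewrite dE big1 // => k _; have := dorth (p k).
rewrite sp ltn_ord => /(_ isT).
rewrite dE mulr_suml LE linear_sum (bigD1 k) // -scalerAl linearZ /= orth.
rewrite eqxx mulr1 big1 ?addr0 => [->|l lk]; first by rewrite scale0r.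
by rewrite -scalerAl LE linearZ /= orth -[(_ == _ :> nat)]/(l == k) (negPf lk) mulr0.
Qed.

(** Symmetry means that negation pushes [mu] forward to itself, so this is a change of variables. *)
Lemma symmetric_Rintegral (R : realType) (mu : {measure set R -> \bar R})
    (f : R -> R) :
  (forall A : set R, measurable A -> mu [set - x | x in A] = mu A) ->
  mu.-integrable setT (EFin \o f) -> mu.-integrable setT (EFin \o (f \o -%R)) ->
  \int[mu]_x f (- x) = \int[mu]_x f x.
Proof.
move=> symmu intf intfN; rewrite /Rintegral; congr fine.
have mN : measurable_fun [set: R] (-%R : R -> R) by exact: measurable_realfun.oppr_measurable.
have := @integral_pushforward _ _ _ _ R _ mN mu setT (EFin \o f).
rewrite preimage_setT => <- //; last by case/integrableP: intf.
apply: eq_measure_integral => A mA _; rewrite /pushforward /= -symmu.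
  congr (mu _); rewrite -[LHS]/(-%R @^-1` A); apply/seteqP.
  by split=> x /= => [Ax|[y Ay <-]]; [exists (- x); rewrite ?opprK | rewrite opprK].
by [].
Qed.

(** * Calculus of power asymptotics *)

(** For [c = 0] this says [u n = o(n ^ s)]. *)
Definition asym {R : realType} (u : nat -> R) (s c : R) :=
  (fun n : nat => u n / n%:R `^ s) @ \oo --> c.

(** The index 0 is set aside because the laws of exponents and the cancellation of powers can fail
    for the base 0. *)
Lemma eq_gt0_cvgn {R : realType} {u v : nat -> R} {l : R} :
  (forall n, (0 < n)%N -> u n = v n) -> u @ \oo --> l -> v @ \oo --> l.
Proof.
move=> uv; apply: cvg_trans; apply: near_eq_cvg; near=> n.
by apply: uv; near: n; exact: nbhs_infty_gt.
Unshelve. all: by end_near. Qed.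

Lemma asym_eq {R : realType} {u : nat -> R} {s c s' c' : R} :
  asym u s c -> s = s' -> c = c' -> asym u s' c'.
Proof. by move=> ? <- <-. Qed.

Lemma asymM {R : realType} {u v : nat -> R} {s t c d : R} :
  asym u s c -> asym v t d -> asym (fun n => u n * v n) (s + t) (c * d).
Proof.
rewrite /asym => us vt; apply: eq_gt0_cvgn (cvgM us vt) => n n0.
by rewrite /= powRD ?pnatr_eq0 -?lt0n ?n0 ?implybT // invfM mulrACA.
Qed.

Lemma asymD {R : realType} {u v : nat -> R} {s c d : R} :
  asym u s c -> asym v s d -> asym (fun n => u n + v n) s (c + d).
Proof.
rewrite /asym => us vs; under eq_fun do rewrite mulrDl; exact: cvgD.
Qed.

Lemma asymZ {R : realType} {u : nat -> R} (k : R) {s c : R} :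
  asym u s c -> asym (fun n => k * u n) s (k * c).
Proof.
rewrite /asym => us; under eq_fun do rewrite -mulrA.
exact: cvgMl_tmp.
Qed.

Lemma asym_powR {R : realType} (s : R) : asym (fun n => n%:R `^ s) s 1.
Proof.
rewrite /asym; apply: (@eq_gt0_cvgn _ (fun=> 1)); last exact: cvg_cst.
by move=> n n0; rewrite divff // powR_eq0 pnatr_eq0 -[n == _]negbK -lt0n n0.
Qed.

Lemma asym_id {R : realType} : @asym R (fun n => n%:R) 1 1.
Proof. by have := @asym_powR R 1; under eq_fun do rewrite powRr1 //. Qed.

Lemma asym_cst {R : realType} (c : R) : @asym R (fun=> c) 0 c.
Proof. by rewrite /asym; under eq_fun do rewrite powRr0 divr1; exact: cvg_cst. Qed.

Lemma powR_natr_cvgy {R : realType} (s : R) : 0 < s ->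
  (fun n : nat => n%:R `^ s : R) @ \oo --> +oo.
Proof.
move=> s0; apply/cvgryPge => A; pose B := Num.max A 1.
have B0 : 0 <= B by rewrite le_max ler01 orbT.
have : \forall n \near \oo, B `^ s^-1 <= n%:R.
  by move/cvgryPge: (@cvgr_idn R); apply.
apply: filterS => n Bn; apply: (@le_trans _ _ B); first by rewrite le_max lexx.
rewrite -[leLHS]powRr1 // -[X in B `^ X](mulVf (lt0r_neq0 s0)) powRrM.
by apply: ge0_ler_powR; rewrite ?nnegrE ?powR_ge0 ?ler0n // ltW.
Qed.

Lemma powR_natr_cvg0 {R : realType} (s : R) : s < 0 ->
  (fun n : nat => n%:R `^ s : R) @ \oo --> (0 : R).
Proof.
move=> s0; have -> : (fun n : nat => n%:R `^ s : R) = fun n => (n%:R `^ (- s))^-1.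
  by apply/funext => n; rewrite -powRN opprK.
have pos : \forall n \near \oo, 0 < n%:R `^ (- s) :> R.
  by near=> n; rewrite powR_gt0 // ltr0n; near: n; exact: nbhs_infty_gt.
by apply/(gtr0_cvgV0 pos)/powR_natr_cvgy; rewrite oppr_gt0.
Unshelve. all: by end_near. Qed.

(** The extra factor [n ^ (s - t)] tends to 0; this is how lower-order terms are discarded. *)
Lemma asym_lt {R : realType} {u : nat -> R} {s t c : R} :
  s < t -> asym u s c -> asym u t 0.
Proof.
rewrite /asym => st us; rewrite -(mulr0 c).
have := @powR_natr_cvg0 R (s - t); rewrite subr_lt0 => /(_ st) st0.
apply: eq_gt0_cvgn (cvgM us st0) => n n0.
have nN0 : n%:R != 0 :> R by rewrite pnatr_eq0 -lt0n.
by rewrite /= powRB ?nN0 ?implybT // mulrA divfK // powR_eq0 (negPf nN0).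
Qed.

(** The ratio [(n + k) / n] tends to 1, and [x ^ s] is continuous at 1. *)
Lemma asym_shift {R : realType} {u : nat -> R} (k : nat) {s c : R} :
  asym u s c -> asym (fun n => u (n + k)%N) s c.
Proof.
rewrite /asym => us; have uk : (fun n => u (n + k)%N / (n + k)%:R `^ s) @ \oo --> c.
  by rewrite (@cvg_shiftn k _ (fun n => u n / n%:R `^ s)).
have := asymD (asym_id) (asym_lt ltr01 (asym_cst (k%:R : R))).
rewrite /asym addr0 => nk.
have ck : (fun n : nat => ((n%:R + k%:R) / n%:R `^ 1) `^ s : R) @ \oo --> (1 : R).
  rewrite [X in _ --> X](_ : _ = 1 `^ s); last by rewrite powR1.
  have cs : {for (1 : R), continuous (fun x : R => x `^ s)}.
    have [d1 _] := @is_derive1_powR R s 1 ltr01.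
    exact/differentiable_continuous/derivable1_diffP.
  exact: (cvg_comp _ _ nk cs).
rewrite -[c]mulr1; apply: eq_gt0_cvgn (cvgM uk ck) => n; rewrite -(@ltr0n R) => n0 /=.
rewrite powRr1 ?ltW // powRM ?invr_ge0 ?(ltW n0) // ?addr_ge0 // -?natrD //.
rewrite -[n%:R^-1]powR_inv1 ?(ltW n0) // -powRrM mulN1r powRN mulrA divfK //.
by rewrite powR_eq0 natrD gt_eqF // ltr_wpDr.
Qed.

(** Divided by [n ^ (t - 1)], the increment is the difference quotient of [x ^ t] at 1 with step
    [1 / n], so it tends to the derivative [t]. *)
Lemma powR_increment_asym {R : realType} (t : R) :
  asym (fun n => n.+1%:R `^ t - n%:R `^ t) (t - 1) t.
Proof.
have : is_derive (1 : R) 1 ((@powR R)^~ t) (t * 1 `^ (t - 1)) by exact: is_derive1_powR.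
rewrite powR1 mulr1 => -[d1 d2].
have {d1}: h^-1 *: (((@powR R)^~ t \o shift (1 : R)) (h *: (1 : R)) - 1 `^ t)
    @[h --> 0^'] --> t.
  by rewrite -[X in _ --> X]d2.
move=> /cvgr_dnbhsP H.
have {H}/H : (forall n, n.+1%:R^-1 != 0 :> R) /\ (fun n => n.+1%:R^-1 : R) @ \oo --> (0 : R).
  split=> [n|]; first by rewrite invr_eq0 pnatr_eq0.
  have pos : \forall n \near \oo, 0 < n.+1%:R :> R by exact: nearW.
  apply/(gtr0_cvgV0 pos).
  rewrite (_ : (fun n => n.+1%:R) = fun n => (n + 1)%:R).
    by rewrite (@cvg_shiftn 1 _ (fun n => n%:R : R) +oo); exact: cvgr_idn.
  by apply/funext => n; rewrite addn1.
(* The steps used are [1 / (n + 1)], which avoids a zero step, so the limit is proved for the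
   sequence shifted by one. *)
move=> H; rewrite /asym -(cvg_shiftn 1); apply: eq_gt0_cvgn H => n _ /=.
rewrite addn1 invrK scaler1 powR1 powRB ?pnatr_eq0 ?implybT // powRr1 //.
rewrite invf_div -[_ *: _]/(_ * _) mulrCA; congr (_ * _).
rewrite (_ : n.+2%:R = n.+1%:R * (n.+1%:R^-1 + 1)); last first.
  by rewrite mulrDr mulr1 mulfV ?pnatr_eq0 // addrC -natr1.
have nt0 : n.+1%:R `^ t != 0 :> R by rewrite powR_eq0 pnatr_eq0.
by rewrite powRM ?addr_ge0 ?invr_ge0 // mulrBl mulrAC divff // mul1r.
Qed.

(** * Stolz-Cesaro summation *)

Lemma stolz_sum {R : realType} {u d : nat -> R} {l : R} :
  (forall n, 0 < d n) -> (fun n => \sum_(i < n) d i) @ \oo --> +oo ->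
  (fun n => u n / d n) @ \oo --> l ->
  (fun n => (\sum_(i < n) u i) / \sum_(i < n) d i) @ \oo --> l.
Proof.
move=> d0 Doo ul; apply/cvgrPdist_le => e e0.
have e2 : 0 < e / 2 by rewrite divr_gt0.
move/cvgrPdist_le : ul => /(_ _ e2)[N _ HN].
(* [T] is nonincreasing from [N] on, since each new error term is at most [e / 2 * d n]; so the
   accumulated error exceeds [e / 2] times the denominator by at most [T N]. *)
pose T n := `|\sum_(i < n) (u i - l * d i)| - e / 2 * \sum_(i < n) d i.
have TN n : (N <= n)%N -> T n <= T N.
  elim: n => [|n IH]; first by rewrite leqn0 => /eqP ->.
  rewrite leq_eqVlt => /predU1P[->//|]; rewrite ltnS => Nn.
  apply: le_trans (IH Nn); rewrite /T !big_ord_recr /=.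
  have := HN n Nn; rewrite /= => Hn.
  have : `|u n - l * d n| <= e / 2 * d n.
    rewrite -ler_pdivrMr // -[X in _ / X](gtr0_norm (d0 n)) -normf_div.
    by rewrite mulrBl mulfK ?gt_eqF // distrC.
  have := ler_normD (\sum_(i < n) (u i - l * d i)) (u n - l * d n).
  lra.
(* The bound 1 makes the denominator positive; the other bound lets the second half of [e] absorb
   [T N]. *)
move/cvgryPge: Doo => /(_ (Num.max 1 (T N / (e / 2)))) => Doo.
near=> n.
have Dn : Num.max 1 (T N / (e / 2)) <= \sum_(i < n) d i by near: n.
have Nn : (N <= n)%N by near: n; exact: nbhs_infty_ge.
move: Dn; rewrite ge_max => /andP[D1]; rewrite ler_pdivrMr // => D2.
have D0 : 0 < \sum_(i < n) d i by lra.
have := TN _ Nn; rewrite {1}/T sumrB -mulr_sumr => Tn.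
rewrite -(ler_pM2r D0) -[X in `|_| * X](gtr0_norm D0) -normrM mulrBl divfK ?gt_eqF //.
rewrite distrC; lra.
Unshelve. all: by end_near. Qed.

(** Stolz-Cesaro against the increments [d] of [n ^ (s + 1)], which telescope and are equivalent to
    [(s + 1) * n ^ s]. *)
Lemma asym_sum {R : realType} {u : nat -> R} {s c : R} : -1 < s ->
  asym u s c -> asym (fun n => \sum_(i < n) u i) (s + 1) (c / (s + 1)).
Proof.
rewrite {1}/asym => s1 us; have t0 : 0 < s + 1 by lra.
pose d n : R := n.+1%:R `^ (s + 1) - n%:R `^ (s + 1).
have dE n : \sum_(i < n) d i = n%:R `^ (s + 1).
  by rewrite -(big_mkord xpredT d) telescope_sumr // powR0 ?subr0 // gt_eqF.
have dgt0 n : 0 < d n by rewrite subr_gt0 gt0_ltr_powR ?nnegrE ?ltr_nat.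
have ud : (fun n => u n / d n) @ \oo --> c / (s + 1).
  have dt : (fun n => d n / n%:R `^ s) @ \oo --> (s + 1).
    by have := powR_increment_asym (s + 1); rewrite /asym addrK.
  apply: eq_gt0_cvgn (cvgM us (cvgV (lt0r_neq0 t0) dt)) => n.
  by rewrite lt0n -(pnatr_eq0 R) => n0; rewrite /= invf_div mulrA divfK // powR_eq0 (negPf n0).
have := stolz_sum dgt0 _ ud; rewrite /asym.
under eq_fun do rewrite dE; move=> /(_ (powR_natr_cvgy _ t0)).
by under eq_fun do rewrite dE.
Qed.

(** * Kernel at the origin and growth of the shifted eigenvalues *)

Lemma derivn_horner0_parity {R : numFieldType} {p : {poly R}} {n : nat} (j : nat) :
  p \Po - 'X = (-1) ^+ n *: p -> odd (n + j) -> p^`(j).[0] = 0.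
Proof.
move=> pN nj; rewrite horner_coef0 coef_derivn addn0.
suff -> : p`_j = 0 by rewrite mul0rn.
have := congr1 (fun q : {poly R} => (-1) ^+ n * q`_j) pN.
rewrite /= coef_comp_polyNX coefZ signrMK mulrA -exprD.
by rewrite -signr_odd nj mulN1r => /eqP; rewrite eqr_oppLR -addr_eq0 -mulr2n mulrn_eq0 => /eqP.
Qed.

(** The parity of [j = b + 2 * r] is carried by the boolean [b]. *)
Lemma Kjj0_parity {R : realType} {p : nat -> {poly R}} (b : bool) (r N : nat) :
  (forall n, p n \Po - 'X = (-1) ^+ n *: p n) ->
  Kjj0 p (b + 2 * r) (b + 2 * N).+1 =
  \sum_(m < N.+1) ((p (b + 2 * m)%N)^`(b + 2 * r)).[0] ^+ 2.
Proof.
move=> pN; rewrite /Kjj0.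
have p0 n : odd (n + b) -> ((p n)^`(b + 2 * r)).[0] ^+ 2 = 0.
  move=> nb; rewrite (derivn_horner0_parity _ (pN n)) ?expr0n //.
  by rewrite addnA oddD oddM addbF.
rewrite (_ : (b + 2 * N).+2 = (b + 2 * N.+1)%N); last by rewrite mulnS; lia.
elim: N.+1 => [|k IH].
  (* For odd parity the leftover term has index 0, which is of the wrong parity. *)
  by case: b p0 => p0; rewrite ?big_ord0 // big_ord_recl !big_ord0 p0 ?addr0.
rewrite (_ : (b + 2 * k.+1 = (b + 2 * k).+2)%N); last by rewrite mulnS; lia.
rewrite 2!big_ord_recr /= IH big_ord_recr /= [X in _ + X]p0 ?addr0 //.
by rewrite addSn oddS addnAC oddD addnn odd_double oddM.
Qed.

(** Treats all four cases at once: [b] is the parity, [g] the order of the increments of [lam] and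
    [h] that of [lam] itself, which [h < g + (2 * e + 1) + 1] makes negligible. *)
Lemma tlambda_shift_asym {R : realType} {lam : nat -> R} {p : nat -> {poly R}}
    (M : R) {b : bool} {r : nat} {C e g c h l : R} :
  (forall n, p n \Po - 'X = (-1) ^+ n *: p n) -> 0 < 2 * e + 1 ->
  (fun n => ((p (b + 2 * n)%N)^`(b + 2 * r)).[0] / (C * (-1) ^+ n * n%:R `^ e))
    @ \oo --> (1 : R) ->
  0 <= g -> h < g + (2 * e + 1) + 1 ->
  asym (fun n => lam (b + 2 * r + 2 * n.+1)%N - lam (b + 2 * r + 2 * n)%N) g c ->
  asym (fun n => lam (b + 2 * r + 2 * n)%N) h l ->
  asym (tlambda_shift lam p M (b + 2 * r)) (g + (2 * e + 1) + 1)
    (M * (c * (C ^+ 2 / (2 * e + 1)) / (g + (2 * e + 1) + 1))).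
Proof.
move=> pN e0 pC g0 hg lamI lamh.
set q := fun n => ((p (b + 2 * n)%N)^`(b + 2 * r)).[0] in pC *.
(* If [C = 0], the quotients in [pC] are divisions by zero, hence all [0]. *)
have C0 : C != 0.
  apply: contraPneq pC => ->; under eq_fun do rewrite !mul0r invr0 mulr0.
  by move=> /(cvg_unique _ (cvg_cst _))-/(_ (@norm_hausdorff _ _))/eqP; rewrite eq_sym oner_eq0.
(* Squaring removes the alternating sign. *)
have q2 : asym (fun n => q n ^+ 2) (2 * e) (C ^+ 2).
  rewrite /asym -[C ^+ 2]mulr1 -[1 in X in _ --> X]mulr1.
  apply: eq_gt0_cvgn (cvgMl_tmp (a := C ^+ 2) (cvgM pC pC)) => n n0 /=.
  have ne0 : n%:R `^ e != 0 :> R by rewrite powR_eq0 pnatr_eq0 -[n == _]negbK -lt0n n0.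
  rewrite [2 * e]mulrC powRrM powR_mulrn ?powR_ge0 //.
  have s0 : (-1) ^+ n != 0 :> R by rewrite signr_eq0.
  transitivity (q n ^+ 2 / (n%:R `^ e) ^+ 2 / ((-1) ^+ n * (-1) ^+ n)).
    rewrite -/(q n); move: (q n) (n%:R `^ e) ((-1) ^+ n) ne0 s0 => x y s y0 s0.
    by field; rewrite y0 s0 C0.
  by rewrite -expr2 sqrr_sign divr1.
have e1 : -1 < 2 * e by lra.
have ge1 : -1 < g + (2 * e + 1) by lra.
(* The two summations produce the two denominators. The shift by [r + 1] appears because the kernel
   in the summand counted from [i = 0] has [i + r + 1] terms of the right parity. *)
have S := asymZ M (asym_sum ge1 (asymM lamI (asym_shift r.+1 (asym_sum e1 q2)))).
have := asymD (asym_lt hg lamh) S; rewrite add0r.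
congr asym; apply/funext => n; rewrite /tlambda_shift /alpha_shift; congr (_ + M * _).
rewrite big_add1 /= big_mkord; apply: eq_bigr => i _; congr ((lam _ - lam _) * _).
  by rewrite mulnS; lia.
rewrite (_ : (b + 2 * r + 2 * i.+1 - 1 = (b + 2 * (i + r)).+1)%N); last by lia.
by rewrite Kjj0_parity // addnS.
Qed.

(** * Growth of [lam] and of its increments of step 2 *)

Lemma affine_asym {R : realType} (a k : R) : asym (fun n => a * n%:R + k) 1 a.
Proof.
apply: asym_eq (asymD (asymZ a asym_id) (asym_lt ltr01 (asym_cst k))) erefl _.
by rewrite mulr1 addr0.
Qed.

Lemma quadratic_asym {R : realType} {lam : nat -> R} {gamma delta : R} (j : nat) :
  (forall n, lam n = gamma * n%:R ^+ 2 + delta * n%:R) ->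
  asym (fun n => lam (j + 2 * n)%N) 2 (4 * gamma) /\
  asym (fun n => lam (j + 2 * n.+1)%N - lam (j + 2 * n)%N) 1 (8 * gamma).
Proof.
move=> lamE; split.
  have lt12 : 1 < 1 + 1 :> R by lra.
  have := asymD (asymZ (4 * gamma) (asymM asym_id asym_id))
    (asym_lt lt12 (affine_asym (4 * gamma * j%:R + 2 * delta)
                               (gamma * j%:R ^+ 2 + delta * j%:R))).
  rewrite !mulr1 addr0; congr asym; apply/funext => n.
  by rewrite lamE natrD natrM; ring.
have := affine_asym (8 * gamma) (4 * gamma * (j%:R + 1) + 2 * delta).
congr asym; apply/funext => n.
by rewrite !lamE !natrD !natrM -natr1; ring.
Qed.

Lemma linear_asym {R : realType} {lam : nat -> R} {delta : R} (j : nat) :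
  (forall n, lam n = delta * n%:R) ->
  asym (fun n => lam (j + 2 * n)%N) 1 (2 * delta) /\
  asym (fun n => lam (j + 2 * n.+1)%N - lam (j + 2 * n)%N) 0 (2 * delta).
Proof.
move=> lamE; split.
  have := affine_asym (2 * delta) (delta * j%:R).
  by congr asym; apply/funext => n; rewrite lamE natrD natrM; ring.
have := asym_cst (2 * delta); congr asym; apply/funext => n.
by rewrite !lamE !natrD !natrM -natr1; ring.
Qed.

(** * Parity for the measure [mu], and the four limits *)

Lemma orthonormal_symmetric_parity {R : realType} {mu : {measure set R -> \bar R}}
    {p : nat -> {poly R}} (n : nat) :
  (forall A : set R, measurable A -> mu [set - x | x in A] = mu A) ->
  (forall n, size (p n) = n.+1) ->
  (forall n m, mu.-integrable setT (fun x => ((p n).[x] * (p m).[x])%:E)) ->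
  (forall n m,
     (\int[mu]_x ((p n).[x] * (p m).[x])%:E = (n == m)%:R%:E)%E) ->
  p n \Po - 'X = (-1) ^+ n *: p n.
Proof.
move=> symmu sp intp orth.
have intf (f : {poly R}) : mu.-integrable setT (EFin \o horner f).
  (* As [p 0] is a nonzero constant, integrability of [p k * p 0] gives that of [p k], and then of
     every polynomial. *)
  have [c0 p0] : exists c, p 0 = c%:P.
    by exists (p 0)`_0; apply: size1_polyC; rewrite sp.
  have c00 : c0 != 0 by rewrite -polyC_eq0 -p0 -size_poly_eq0 sp.
  have intpk k : mu.-integrable setT (EFin \o horner (p k)).
    have := integrableZl measurableT c0^-1 (intp k 0%N).
    apply: eq_integrable => // x _.
    by rewrite /= p0 hornerC -EFinM mulrC mulfK.
  have [c ->] := poly_basis_span sp (leqnn (size f)).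
  elim: (size f) => [|m IH].
    rewrite big_ord0; apply: eq_integrable (integrable0 _ _) => //= x _.
    by rewrite horner0.
  rewrite big_ord_recr /=.
  have := integrableD measurableT IH (integrableZl measurableT (c m) (intpk m)).
  apply: eq_integrable => // x _.
  by rewrite /= hornerD hornerZ -EFinM -EFinD.
apply: (@orthonormal_comp_polyNX _ (fun f => \int[mu]_x f.[x])) => //.
- move=> a f g; under eq_Rintegral do rewrite hornerD hornerZ.
  have intaf : mu.-integrable setT (EFin \o (fun x => a * f.[x])).
    have := intf (a *: f); apply: eq_integrable => // x _.
    by rewrite /= hornerZ.
  rewrite (RintegralD measurableT intaf (intf g)).
  by rewrite (RintegralZl _ measurableT (intf f)).
- move=> f; under eq_Rintegral do rewrite horner_comp hornerN hornerX.
  apply: symmetric_Rintegral => //.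
  have := intf (f \Po - 'X); apply: eq_integrable => // x _.
  by rewrite /= horner_comp hornerN hornerX.
- by move=> k l; rewrite /Rintegral; under eq_integral do rewrite hornerM; rewrite orth.
Qed.

Theorem theorem2 (R : realType) (mu : {measure set R -> \bar R})
  (p : nat -> {poly R}) (sigma tau : {poly R}) (lam : nat -> R)
  (gamma delta M : R) (j : nat)
  (C1 C2 : nat -> R) (a1 b1 a2 b2 : R)
  (* mu symmetric with respect to the origin *)
  (Hsym : forall A : set R, measurable A -> mu [set - x | x in A] = mu A)
  (* p_n is the orthonormal polynomial of degree n (positive leading coef.) *)
  (Hdeg : forall n, size (p n) = n.+1)
  (Hlead : forall n, 0 < lead_coef (p n))
  (Hint : forall n m, mu.-integrable setT (fun x => ((p n).[x] * (p m).[x])%:E))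
  (Horth : forall n m,
     (\int[mu]_x ((p n).[x] * (p m).[x])%:E = (n == m)%:R%:E)%E)
  (* p_n eigenfunctions of B = sigma D^2 + tau D with eigenvalues lambda_n *)
  (Hsig : (size sigma <= 3)%N) (Htau : (size tau <= 2)%N)
  (Heig : forall n, sigma * (p n)^`(2) + tau * (p n)^`() = lam n *: p n)
  (Hlam : forall n, lam n = gamma * n%:R ^+ 2 + delta * n%:R)
  (HM : 0 < M)
  (* asymptotics of the derivatives at 0 *)
  (Has1 : forall k, (fun n : nat => ((p (2 * n)%N)^`(2 * k)).[0]
            / (C1 k * (-1) ^+ n * n%:R `^ (a1 * k%:R + b1))) @ \oo --> (1 : R))
  (Has2 : forall k, (fun n : nat => ((p (2 * n).+1)^`((2 * k).+1)).[0]
            / (C2 k * (-1) ^+ n * n%:R `^ (a2 * k%:R + b2))) @ \oo --> (1 : R))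
  (Hpos1 : forall k, 0 < 2 * (a1 * k%:R + b1) + 1)
  (Hpos2 : forall k, 0 < 2 * (a2 * k%:R + b2) + 1) :
  (forall r, j = (2 * r)%N ->
     (gamma != 0 ->
       (fun n : nat => tlambda_shift lam p M j n / n%:R `^ (2 * (a1 * r%:R + b1) + 3))
         @ \oo --> (8 * gamma * M * C1 r ^+ 2
                   / ((2 * (a1 * r%:R + b1) + 3) * (2 * (a1 * r%:R + b1) + 1)) : R))
     /\
     (gamma = 0 ->
       (fun n : nat => tlambda_shift lam p M j n / n%:R `^ (2 * (a1 * r%:R + b1 + 1)))
         @ \oo --> (delta * M * C1 r ^+ 2
                   / ((a1 * r%:R + b1 + 1) * (2 * (a1 * r%:R + b1) + 1)) : R)))
  /\
  (forall r, j = (2 * r).+1 ->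
     (gamma != 0 ->
       (fun n : nat => tlambda_shift lam p M j n / n%:R `^ (2 * (a2 * r%:R + b2) + 3))
         @ \oo --> (8 * gamma * M * C2 r ^+ 2
                   / ((2 * (a2 * r%:R + b2) + 3) * (2 * (a2 * r%:R + b2) + 1)) : R))
     /\
     (gamma = 0 ->
       (fun n : nat => tlambda_shift lam p M j n / n%:R `^ (2 * (a2 * r%:R + b2 + 1)))
         @ \oo --> (delta * M * C2 r ^+ 2
                   / ((a2 * r%:R + b2 + 1) * (2 * (a2 * r%:R + b2) + 1)) : R))).
Proof.
have pN n := orthonormal_symmetric_parity n Hsym Hdeg Hint Horth.
have gamma0 : gamma = 0 -> forall n, lam n = delta * n%:R.
  by move=> g0 n; rewrite Hlam g0 mul0r add0r.
split=> r ->; split=> [_|/gamma0 lamE].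
- have [e0 [L I]] := (Hpos1 r, quadratic_asym (2 * r) Hlam).
  set e := a1 * r%:R + b1 in e0 *.
  have h : 2 < 1 + (2 * e + 1) + 1 by lra.
  have := tlambda_shift_asym M (b := false) pN e0 (Has1 r) ler01 h I L.
  move/asym_eq; apply; first by lra.
  by field; lra.
- have [e0 [L I]] := (Hpos1 r, linear_asym (2 * r) lamE).
  set e := a1 * r%:R + b1 in e0 *.
  (* Here the increments are the constant [2 * delta]; the 2 cancels against the denominator
     [2 * e + 2]. *)
  have h : 1 < 0 + (2 * e + 1) + 1 by lra.
  have := tlambda_shift_asym M (b := false) pN e0 (Has1 r) (lexx 0) h I L.
  move/asym_eq; apply; first by lra.
  by field; lra.
- have [e0 [L I]] := (Hpos2 r, quadratic_asym (2 * r).+1 Hlam).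
  set e := a2 * r%:R + b2 in e0 *.
  have h : 2 < 1 + (2 * e + 1) + 1 by lra.
  have := tlambda_shift_asym M (b := true) pN e0 (Has2 r) ler01 h I L.
  move/asym_eq; apply; first by lra.
  by field; lra.
- have [e0 [L I]] := (Hpos2 r, linear_asym (2 * r).+1 lamE).
  set e := a2 * r%:R + b2 in e0 *.
  have h : 1 < 0 + (2 * e + 1) + 1 by lra.
  have := tlambda_shift_asym M (b := true) pN e0 (Has2 r) (lexx 0) h I L.
  move/asym_eq; apply; first by lra.
  by field; lra.
Qed.
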